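(* There is a constant $C>0$ such that for every integer $d\ge 2$ there exists a generic real pencil of surfaces of degree $d$ in $\mathbb{P}^3$ that contains at least $\frac{3}{2}d^3-Cd^2$ real singular surfaces (i.e. at least $\frac32 d^3+O(d^2)$ real singular surfaces).
   Context: Surfaces of degree $d$ in $\mathbb P^3$ are identified with nonzero polynomials in three variables whose support is contained in the simplex $\Delta^3_d=\mathrm{Conv}\{(0,0,0),(d,0,0),(0,d,0),(0,0,d)\}$, up to multiplication by a nonzero scalar. A surface is called singular if it has a singular point in the big torus $(\mathbb C^* )^3$. A real pencil is a one-dimensional linear system (a line in the projective space of surfaces of degree $d$) defined over $\mathbb R$; a real surface is one defined by a polynomial with real coefficients. A pencil is called generic if it contains only finitely many surfaces with a singularity in the big torus $(\mathbb C^* )^3$. *)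

(* Defs.v *)
From HB Require Import structures.
From mathcomp Require Import all_boot all_order all_algebra.
From mathcomp Require Import reals.
From mathcomp Require Import mpoly complex.

Set Implicit Arguments.
Unset Strict Implicit.
Unset Printing Implicit Defensive.

Import Order.TTheory GRing.Theory Num.Theory.

Local Open Scope ring_scope.
Local Open Scope complex_scope.

Section Surfaces.
Variable R : realType.

(* A surface in P^3 is a nonzero polynomial in three variables considered up   *)
(* to multiplication by a nonzero scalar. We work with representatives and     *)
(* compare them with [same_surface].                                           *)

Definition in_simplex (d : nat) (p : {mpoly R[i][3]}) : Prop :=
  forall m : 'X_{1..3}, m \in msupp p -> (mdeg m <= d)%N.

Definition same_surface (p q : {mpoly R[i][3]}) : Prop :=
  exists2 c : R[i], c != 0 & q = c *: p.

Definition complexify (p : {mpoly R[3]}) : {mpoly R[i][3]} :=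
  map_mpoly (real_complex R) p.

Definition real_surface (p : {mpoly R[i][3]}) : Prop :=
  exists q : {mpoly R[3]}, same_surface p (complexify q).

Definition singular_point (p : {mpoly R[i][3]}) (v : 'I_3 -> R[i]) : Prop :=
  p.@[v] = 0 /\ forall i : 'I_3, (p^`M(i)).@[v] = 0.

Definition singular_surface (p : {mpoly R[i][3]}) : Prop :=
  exists2 v : 'I_3 -> R[i], (forall i, v i != 0) & singular_point p v.

Definition spanned_by (f g p : {mpoly R[i][3]}) : Prop :=
  p != 0 /\ exists s t : R[i], p = s *: f + t *: g.

(* A linear system is given by the set [L] of the nonzero polynomials that     *)
(* define its surfaces; this set is closed under nonzero scaling.              *)
Definition is_pencil (d : nat) (L : {mpoly R[i][3]} -> Prop) : Prop :=
  exists f g : {mpoly R[i][3]},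
    [/\ in_simplex d f, in_simplex d g,
        (forall s t : R[i], s *: f + t *: g = 0 -> s = 0 /\ t = 0)
      & forall p, L p <-> spanned_by f g p].

Definition is_real_pencil (d : nat) (L : {mpoly R[i][3]} -> Prop) : Prop :=
  is_pencil d L /\
  exists f g : {mpoly R[3]},
    forall p, L p <-> spanned_by (complexify f) (complexify g) p.

Definition generic_pencil (L : {mpoly R[i][3]} -> Prop) : Prop :=
  exists (n : nat) (F : 'I_n -> {mpoly R[i][3]}),
    forall p, L p -> singular_surface p -> exists i, same_surface (F i) p.

Definition has_real_singular_surfaces
    (L : {mpoly R[i][3]} -> Prop) (n : nat) : Prop :=
  exists F : 'I_n -> {mpoly R[i][3]},
    (forall i, [/\ L (F i), real_surface (F i) & singular_surface (F i)]) /\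
    (forall i j, same_surface (F i) (F j) -> i = j).

End Surfaces.

(* Main.v *)
(** Take P with roots 2, 4, ..., 2^d and Q with roots D 2, D 4, ..., D 2^d, where
    D = 8^d. The pencil is spanned by P(x) + eps (P(y) + lam P(z)) and Q(x). A
    member P(x) + eps (P(y) + lam P(z)) + t Q(x) is singular at (x, y, z) when y
    and z are critical points of P and x is a double root of the univariate
    polynomial P + c + t Q, with c = eps (P(y) + lam P(z)).

    For c = 0 the suitable t are minus the critical values of P/Q. This function
    has an extremum between any two consecutive zeros and between any two
    consecutive poles, which makes 2(d - 1) values of t. They are distinct since
    |P/Q| increases under x -> 2x on these gaps and is smaller near the zeros than
    near the poles. Each extremum persists for small c, and then t is an injective
    function of c. The (d - 1)^2 pairs (y, z) give distinct small values of c, so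
    the pencil has at least 2(d - 1)^3 real singular members. *)

From mathcomp Require Import all_boot all_order all_algebra.
From mathcomp Require Import reals.
From mathcomp Require Import separable polyorder polyrcf ring lra.
From mathcomp Require boolp.
From mathcomp Require classical_sets topology subspace_topology normedtype derive realfun.
Set Implicit Arguments.
Unset Strict Implicit.
Unset Printing Implicit Defensive.

Import Order.TTheory GRing.Theory Num.Theory.
Local Open Scope ring_scope.

(** * Extrema of quotients of polynomials on a segment *)

Section RatioMax.
Import classical_sets topology subspace_topology normedtype derive realfun.
Import numFieldNormedType.Exports.

Lemma ratio_max (R : realType) (P Q : {poly R}) (a b : R) : a <= b ->
  (forall x, a <= x <= b -> Q.[x] != 0) ->
  exists2 m, a <= m <= b &
    forall x, a <= x <= b -> P.[x] / Q.[x] <= P.[m] / Q.[m].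
Proof.
move=> leab Q0.
have hc p : continuous (horner p : R -> R) by exact: continuous_horner.
have [|m mab mmax] := @EVT_max R (fun x => P.[x] / Q.[x]) a b leab; last first.
  exists m => [|x xab]; first by move: mab; rewrite in_itv.
  by apply: mmax; rewrite in_itv.
apply: continuous_in_subspaceT => x; rewrite inE /= => xab.
apply: (@continuousM R R^o); first exact: hc.
apply: continuousV; last exact: hc.
by apply: Q0; move: xab; rewrite in_itv.
Qed.
End RatioMax.

Lemma horner_lt_near (R : rcfType) (p : {poly R}) (x u : R) : u < p.[x] ->
  exists2 d : R, 0 < d & forall y, `|y - x| < d -> u < p.[y].
Proof.
rewrite -subr_gt0 => h; have [d d0 hd] := poly_cont x p h.
exists d => // y /hd; rewrite ltr_norml => /andP[]; lra.
Qed.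

(** Fermat's rule, proved algebraically. Writing [F = G * ('X - m)] gives [F'(m) = G(m)]; if [G(m)]
    were positive, [F] would be positive just to the right of [m], and if negative, just to the
    left. *)
Lemma deriv_interior_max (R : rcfType) (F : {poly R}) (a b m : R) :
  a < m < b -> F.[m] = 0 -> (forall x, a <= x <= b -> F.[x] <= 0) ->
  F^`().[m] = 0.
Proof.
move=> /andP[am mb] /eqP Fm0 Fle; have /factor_theorem[G FE] : root F m by [].
have -> : F^`().[m] = G.[m].
  by rewrite FE !derivE !hornerE; ring.
apply/eqP; rewrite eq_le; apply/andP; split; rewrite leNgt; apply/negP => Gm.
  have [d d0 hd] := horner_lt_near Gm.
  (* The minimum with [b] keeps the test point inside the segment where [F] is known to be
     nonpositive. *)
  pose y := Num.min b (m + d / 2).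
  have hy : [/\ m < y, y <= b & y - m < d].
    by rewrite /y; case: (leP b (m + d / 2)) => ?; split; lra.
  case: hy => my yb yd; have /hd Gy : `|y - m| < d by rewrite gtr0_norm; lra.
  have /Fle : a <= y <= b by apply/andP; split; lra.
  by rewrite FE !hornerE leNgt => /negP; apply; rewrite mulr_gt0 // subr_gt0.
have [d d0 hd] : exists2 d : R, 0 < d & forall y, `|y - m| < d -> 0 < (- G).[y].
  by apply: horner_lt_near; rewrite hornerN oppr_gt0.
pose y := Num.max a (m - d / 2).
have hy : [/\ y < m, a <= y & m - y < d].
  by rewrite /y; case: (leP a (m - d / 2)) => ?; split; lra.
case: hy => my yb yd; have /hd : `|y - m| < d by rewrite ltr0_norm; lra.
rewrite hornerN oppr_gt0 => Gy.
have /Fle : a <= y <= b by apply/andP; split; lra.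
rewrite FE !hornerE leNgt => /negP; apply.
by rewrite nmulr_rgt0 // subr_lt0.
Qed.

(** * Double roots of [P + c + t Q] that persist for small [c] *)

Definition double_root (R : nzRingType) (p : {poly R}) (x : R) : Prop :=
  p.[x] = 0 /\ p^`().[x] = 0.

(* [T c] is the parameter of the member of the pencil [P + c + t Q] that has the
   double root continuing the one of the member [t0] at [c = 0]. *)
Definition stable_contact (R : realType) (P Q : {poly R}) (t0 : R) : Prop :=
  exists (T : R -> R) (K eta : R),
    [/\ 0 < K, 0 < eta, injective T, (forall c : R, `|T c - t0| <= K * `|c|)
      & forall c : R, `|c| < eta ->
          exists2 x : R, 0 < x & double_root (P + c%:P + T c *: Q) x].

(** The function [T] sends [c] to minus the maximum of [(P + c) / Q] on [[a, b]]. Changing [c] moves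
    this maximum by at most [|c|] times a bound of [1 / |Q|], and the strict inequalities at [a] and
    [b] keep the maximizer in the interior for small [c], where it is a double root. *)
Lemma stable_contact_max (R : realType) (P Q : {poly R}) (a b m : R) :
  0 < a -> a < m < b ->
  (forall x, a <= x <= b -> Q.[x] != 0) ->
  (forall x, a <= x <= b -> P.[x] / Q.[x] <= P.[m] / Q.[m]) ->
  P.[a] / Q.[a] < P.[m] / Q.[m] -> P.[b] / Q.[b] < P.[m] / Q.[m] ->
  stable_contact P Q (- (P.[m] / Q.[m])).
Proof.
move=> a0 /andP[am mb] Q0 gm ga gb.
have ab : a <= b by lra.
have mab : a <= m <= b by apply/andP; split; lra.
have aab : a <= a <= b by apply/andP; split; lra.
have bab : a <= b <= b by apply/andP; split; lra.
(* Maximizing [1 / Q^2] avoids absolute values; then [|u| <= 1 + u^2] bounds [1 / |Q|]. *)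
have [K K0 hK] : exists2 K : R, 0 < K & forall x, a <= x <= b -> `|Q.[x]^-1| <= K.
  have [|z zab hz] := @ratio_max R 1 (Q ^+ 2) a b ab.
    by move=> x /Q0; rewrite horner_exp; apply: expf_neq0.
  exists (1 + (1 : {poly R}).[z] / (Q ^+ 2).[z]) => [|x xab].
    by rewrite ltr_wpDr // hornerC mul1r invr_ge0 horner_exp sqr_ge0.
  apply: le_trans (_ : 1 + Q.[x]^-1 ^+ 2 <= _); last first.
    rewrite lerD2l; have := hz x xab.
    by rewrite !hornerC !horner_exp !mul1r exprVn.
  rewrite -real_normK ?num_real //; have := sqr_ge0 (`|Q.[x]^-1| - 1); nra.
have sgQ : forall x y, a <= x <= b -> a <= y <= b -> Num.sg Q.[x] = Num.sg Q.[y].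
  move=> x y hx hy; apply: (@polyrN0_itv R `[a, b]); rewrite ?in_itv //.
have /boolp.choice[z hz] : forall c, exists z, a <= z <= b /\
    forall x, a <= x <= b -> (P.[x] + c) / Q.[x] <= (P.[z] + c) / Q.[z].
  move=> c; have [z zab hz] := ratio_max (P + c%:P) ab Q0.
  by exists z; split=> // x /hz; rewrite !hornerD !hornerC.
have near c x : a <= x <= b -> `|(P.[x] + c) / Q.[x] - P.[x] / Q.[x]| <= K * `|c|.
  move=> xab; rewrite -mulrBl addrAC subrr add0r normrM mulrC.
  by rewrite ler_wpM2r ?normr_ge0 // hK.
pose mu c := (P.[z c] + c) / Q.[z c].
have hmu c : P.[m] / Q.[m] - K * `|c| <= mu c <= P.[m] / Q.[m] + K * `|c|.
  have [zab zmax] := hz c; have := zmax m mab; have := gm _ zab.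
  have := near c _ mab; have := near c _ zab; rewrite -/(mu c) !ler_norml.
  by move=> /andP[? ?] /andP[? ?] ? ?; apply/andP; split; lra.
pose D := Num.min (P.[m] / Q.[m] - P.[a] / Q.[a]) (P.[m] / Q.[m] - P.[b] / Q.[b]).
have D0 : 0 < D by rewrite lt_min; apply/andP; split; lra.
(* The value of [(P + c) / Q] at an end point and its maximum each move by at most [K |c|], so
   [2 K |c| < D] excludes a maximizer at an end. *)
exists (fun c => - mu c), K, (D / (2 * K)).
split=> // [|c c' /oppr_inj mucc'|c|c].
- by rewrite divr_gt0 // mulr_gt0.
- have [zab zmax] := hz c; have [zab' zmax'] := hz c'.
  have le1 : (c' - c) / Q.[z c] <= 0.
    have := zmax' _ zab; rewrite -/(mu c') -mucc' /mu -subr_le0 -mulrBl.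
    by congr (_ / _ <= 0); ring.
  have le2 : (c - c') / Q.[z c'] <= 0.
    have := zmax _ zab'; rewrite -/(mu c) mucc' /mu -subr_le0 -mulrBl.
    by congr (_ / _ <= 0); ring.
  have sgE := sgQ _ _ zab zab'.
  have := Q0 _ zab; case: (ltgtP Q.[z c] 0) => // hQ _.
    have hQ' : Q.[z c'] < 0 by rewrite -sgr_cp0 -sgE sgr_cp0.
    by move: le1 le2; rewrite !nmulr_lle0 ?invr_lt0 //; lra.
  have hQ' : 0 < Q.[z c'] by rewrite -sgr_cp0 -sgE sgr_cp0.
  by move: le1 le2; rewrite !pmulr_lle0 ?invr_gt0 //; lra.
- by rewrite opprK ler_norml; move: (hmu c) => /andP[? ?]; apply/andP; split; lra.
rewrite ltr_pdivlMr ?mulr_gt0 // => cD.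
have [zab zmax] := hz c; have /andP[za zb] := zab.
have muE y : a <= y <= b -> z c = y -> P.[m] / Q.[m] - P.[y] / Q.[y] <= `|c| * (2 * K).
  move=> yab zy; have /andP[h _] := hmu c; have := near c _ yab; move: h.
  by rewrite /mu zy ler_norml => h /andP[? ?]; lra.
have za' : a < z c.
  rewrite lt_neqAle za andbT; apply/negP => /eqP zE.
  have := muE _ aab (esym zE); have : D <= P.[m] / Q.[m] - P.[a] / Q.[a].
    by rewrite ge_min lexx.
  lra.
have zb' : z c < b.
  rewrite lt_neqAle zb andbT; apply/negP => /eqP zE.
  have := muE _ bab zE; have : D <= P.[m] / Q.[m] - P.[b] / Q.[b].
    by rewrite ge_min lexx orbT.
  lra.
exists (z c); first by lra.
pose F := P + c%:P + - mu c *: Q.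
have FE x : a <= x <= b -> F.[x] = Q.[x] * ((P.[x] + c) / Q.[x] - mu c).
  by move=> xab; rewrite !hornerE; field; apply: Q0.
have Fz : F.[z c] = 0 by rewrite FE // subrr mulr0.
split=> //; have sg0 : Num.sg Q.[m] != 0 by rewrite sgr_eq0 Q0.
(* Multiplying [F] by the sign of [Q] makes it nonpositive on the whole segment, with the value 0 at
   [z c]. *)
apply: (mulfI sg0); rewrite mulr0 -hornerZ -derivZ.
apply: (@deriv_interior_max R _ a b); rewrite ?za' ?zb' //.
  by rewrite hornerZ Fz mulr0.
move=> x xab; rewrite hornerZ FE // mulrA (sgQ m x) // -normrEsg.
by rewrite mulr_ge0_le0 ?normr_ge0 // subr_le0 zmax.
Qed.

Lemma stable_contactN (R : realType) (P Q : {poly R}) (t : R) :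
  stable_contact P (- Q) t -> stable_contact P Q (- t).
Proof.
move=> [T [K [eta [K0 eta0 Tinj TK Tc]]]]; exists (fun c => - T c), K, eta.
split=> // [c c' /oppr_inj /Tinj //|c|c /Tc[x x0 hx]].
  by rewrite -opprD normrN.
by exists x; rewrite // scaleNr -scalerN.
Qed.

Lemma stable_contact_min (R : realType) (P Q : {poly R}) (a b m : R) :
  0 < a -> a < m < b ->
  (forall x, a <= x <= b -> Q.[x] != 0) ->
  (forall x, a <= x <= b -> P.[m] / Q.[m] <= P.[x] / Q.[x]) ->
  P.[m] / Q.[m] < P.[a] / Q.[a] -> P.[m] / Q.[m] < P.[b] / Q.[b] ->
  stable_contact P Q (- (P.[m] / Q.[m])).
Proof.
move=> a0 amb Q0 gm ga gb.
have gN x : P.[x] / (- Q).[x] = - (P.[x] / Q.[x]) by rewrite hornerN invrN mulrN.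
rewrite -gN -[P.[m] / _]opprK; apply/stable_contactN.
apply: (@stable_contact_max R P (- Q) a b m) => //; rewrite ?gN ?ltrN2 //.
  by move=> x /Q0; rewrite hornerN oppr_eq0.
by move=> x xab; rewrite !gN lerN2 gm.
Qed.

(** The point [m] maximizes [(P / Q)^2], hence [|P / Q|]. According to the sign of [P / Q] at [m],
    it is a maximum or a minimum of [P / Q]. *)
Lemma zero_gap_contact (R : realType) (P Q : {poly R}) (a b : R) :
  0 < a < b -> P.[a] = 0 -> P.[b] = 0 ->
  (forall x, a < x < b -> P.[x] != 0) -> (forall x, a <= x <= b -> Q.[x] != 0) ->
  exists m, [/\ a < m < b,
    (forall x, a <= x <= b -> `|P.[x] / Q.[x]| <= `|P.[m] / Q.[m]|)
    & stable_contact P Q (- (P.[m] / Q.[m]))].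
Proof.
move=> /andP[a0 ab] Pa Pb P0 Q0.
have [x /Q0 Qx|m mab mmax] := @ratio_max R (P ^+ 2) (Q ^+ 2) a b (ltW ab).
  by rewrite horner_exp expf_neq0.
have gmax x : a <= x <= b -> `|P.[x] / Q.[x]| <= `|P.[m] / Q.[m]|.
  move=> /mmax; rewrite !horner_exp -!expr_div_n -!(real_normK (num_real (_ / _))).
  by rewrite ler_pXn2r ?nnegrE.
(* The midpoint shows that the maximum of [|P / Q|] is positive, so it is not attained at the zeros
   [a] and [b]. *)
pose h := (a + b) / 2.
have hab : a < h < b by apply/andP; rewrite /h; split; lra.
have hab' : a <= h <= b by apply/andP; rewrite /h; split; lra.
have gm0 : 0 < `|P.[m] / Q.[m]|.
  apply: lt_le_trans (gmax _ hab'); rewrite normr_gt0 mulf_neq0 ?invr_eq0 //.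
    exact: P0.
  exact: Q0.
have amb : a < m < b.
  case/andP: mab => am mb; rewrite !lt_neqAle am mb !andbT.
  apply/andP; split; apply: contraL gm0 => /eqP E.
    by rewrite -E Pa mul0r normr0 ltxx.
  by rewrite E Pb mul0r normr0 ltxx.
exists m; split=> //; have := gm0; rewrite normr_gt0 real_neqr_lt ?num_real //.
case/orP => gm.
  apply: (@stable_contact_min R P Q a b) => //; rewrite ?Pa ?Pb ?mul0r //.
  move=> x /gmax; rewrite (ltr0_norm gm) ler_norml => /andP[]; lra.
apply: (@stable_contact_max R P Q a b) => //; rewrite ?Pa ?Pb ?mul0r //.
by move=> x /gmax; rewrite (gtr0_norm gm) ler_norml => /andP[].
Qed.

(** Exchanging [P] and [Q] turns poles into zeros, so [m] is found as a maximum of [|Q / P|]. The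
    contact itself is obtained on a smaller segment [[a', b']] that avoids the poles and at whose
    ends [|P / Q|] is still larger than at [m]. *)
Lemma pole_gap_contact (R : realType) (P Q : {poly R}) (a b : R) :
  0 < a < b -> Q.[a] = 0 -> Q.[b] = 0 ->
  (forall x, a < x < b -> Q.[x] != 0) -> (forall x, a <= x <= b -> P.[x] != 0) ->
  exists m, [/\ a < m < b,
    (forall x, a < x < b -> `|P.[m] / Q.[m]| <= `|P.[x] / Q.[x]|)
    & stable_contact P Q (- (P.[m] / Q.[m]))].
Proof.
move=> /andP[a0 ab] Qa Qb Q0 P0.
have [|m [amb gmax _]] := @zero_gap_contact R Q P a b _ Qa Qb Q0 P0.
  by rewrite a0.
have sub x : a < x < b -> a <= x <= b by case/andP=> ? ?; rewrite !ltW.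
have gmin x : a < x < b -> `|P.[m] / Q.[m]| <= `|P.[x] / Q.[x]|.
  move=> xab; rewrite -[P.[m] / _]invf_div -[P.[x] / _]invf_div !normfV.
  have Qx := Q0 _ xab; have Px := P0 _ (sub _ xab).
  have Qm := Q0 _ amb; have Pm := P0 _ (sub _ amb).
  by rewrite lef_pV2 ?posrE ?normr_gt0 ?mulf_neq0 ?invr_eq0 // gmax ?sub.
exists m; split=> //.
have [am mb] := andP amb.
have Qm := Q0 _ amb.
(* Inside the gap, [D] is positive where [|P / Q|] exceeds its value at [m]. Being a polynomial, it
   also makes sense at the poles; it is positive there, hence near them by continuity. *)
pose D := Q.[m] ^+ 2 *: P ^+ 2 - P.[m] ^+ 2 *: Q ^+ 2.
have DE x : D.[x] = (Q.[m] * P.[x]) ^+ 2 - (P.[m] * Q.[x]) ^+ 2.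
  by rewrite /D hornerD hornerN !hornerZ !horner_exp; ring.
have Dgt x : a < x < b -> 0 < D.[x] -> `|P.[m] / Q.[m]| < `|P.[x] / Q.[x]|.
  move=> /Q0 Qx; rewrite DE subr_gt0 -![(_ * _) ^+ 2](real_normK (num_real _)).
  rewrite ltr_pXn2r ?nnegrE // !normrM !normfV => ?.
  by rewrite ltr_pdivrMr ?normr_gt0 // mulrAC ltr_pdivlMr ?normr_gt0 // [ltRHS]mulrC.
have D0 x : a <= x <= b -> Q.[x] = 0 -> 0 < D.[x].
  move=> /P0 Px Qx; rewrite DE Qx mulr0 expr0n subr0 exprn_even_gt0 //=.
  by rewrite mulf_neq0.
have [d d0 hd] : exists2 d : R, 0 < d & forall y, `|y - a| < d -> 0 < D.[y].
  by apply: horner_lt_near; apply: D0; rewrite ?lexx ?ltW.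
have [e e0 he] : exists2 d : R, 0 < d & forall y, `|y - b| < d -> 0 < D.[y].
  by apply: horner_lt_near; apply: D0; rewrite ?lexx ?ltW.
have [a' [aa' a'm Da']] : exists a', [/\ a < a', a' < m & 0 < D.[a']].
  pose y := Num.min ((a + m) / 2) (a + d / 2).
  have [? ? ?] : [/\ a < y, y < m & y - a < d].
    by rewrite /y; case: (leP ((a + m) / 2) (a + d / 2)) => ?; split; lra.
  by exists y; split=> //; apply: hd; rewrite gtr0_norm; lra.
have [b' [b'b mb' Db']] : exists b', [/\ b' < b, m < b' & 0 < D.[b']].
  pose y := Num.max ((b + m) / 2) (b - e / 2).
  have [? ? ?] : [/\ y < b, m < y & b - y < e].
    by rewrite /y; case: (leP ((b + m) / 2) (b - e / 2)) => ?; split; lra.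
  by exists y; split=> //; apply: he; rewrite ltr0_norm; lra.
have in' x : a' <= x <= b' -> a < x < b by case/andP=> *; apply/andP; split; lra.
have a'in : a < a' < b by apply: in'; apply/andP; split; lra.
have b'in : a < b' < b by apply: in'; apply/andP; split; lra.
have a'0 : 0 < a' by lra.
have a'mb' : a' < m < b' by rewrite a'm.
have Q0' x : a' <= x <= b' -> Q.[x] != 0 by move/in'/Q0.
have ga := Dgt _ a'in Da'; have gb := Dgt _ b'in Db'.
have sgQ x : a < x < b -> Num.sg Q.[x] = Num.sg Q.[m].
  move=> hx; apply: (@polyrN0_itv R `]a, b[); rewrite ?in_itv //.
have sgP x : a < x < b -> Num.sg P.[x] = Num.sg P.[m].
  move=> hx; apply: (@polyrN0_itv R `[a, b]); rewrite ?in_itv //=; exact: sub.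
have sgg x : a < x < b -> Num.sg (P.[x] / Q.[x]) = Num.sg (P.[m] / Q.[m]).
  by move=> hx; rewrite !sgrM !sgrV sgQ // sgP.
have := mulf_neq0 (P0 _ (sub _ amb)) (invr_neq0 Qm).
rewrite real_neqr_lt ?num_real // => /orP[gm|gm].
  have neg x : a < x < b -> P.[x] / Q.[x] < 0.
    by move=> hx; rewrite -sgr_cp0 sgg // sgr_cp0.
  apply: (@stable_contact_max R P Q a' b') => //.
  - by move=> x /in' hx; have := gmin x hx; rewrite !ltr0_norm ?neg // lerN2.
  - by move: ga; rewrite !ltr0_norm ?neg // ltrN2.
  - by move: gb; rewrite !ltr0_norm ?neg // ltrN2.
have pos x : a < x < b -> 0 < P.[x] / Q.[x].
  by move=> hx; rewrite -sgr_cp0 sgg // sgr_cp0.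
apply: (@stable_contact_min R P Q a' b') => //.
- by move=> x /in' hx; have := gmin x hx; rewrite !gtr0_norm ?pos.
- by move: ga; rewrite !gtr0_norm ?pos.
- by move: gb; rewrite !gtr0_norm ?pos.
Qed.

(** * Polynomials whose roots form a geometric progression *)

Definition geom_poly (R : comNzRingType) (D : R) (d : nat) : {poly R} :=
  \prod_(i < d) ('X - (D * 2 ^+ i.+1)%:P).

Section GeomPoly.
Variables (R : realFieldType) (D : R).
Implicit Types (d k : nat) (x : R).

(** Since [2 x - D 2^(i+1) = 2 (x - D 2^i)], doubling [x] shifts the roots by one place: up to the
    factor [2^d], the root [D 2^d] is replaced by [D]. The identity is stated without division so
    that it holds at every [x]. *)
Lemma geom_poly_doubling d x :
  (geom_poly D d).[2 * x] * (x - D * 2 ^+ d)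
  = 2 ^+ d * (geom_poly D d).[x] * (x - D).
Proof.
elim: d => [|d IH]; first by rewrite /geom_poly !big_ord0 !hornerE.
rewrite /geom_poly !big_ord_recr /= -!/(geom_poly D d) !hornerM !hornerXsubC.
rewrite exprS; move: (2 ^+ d) _.[2 * x] _.[x] IH => A G2 G1 IH.
have -> : G2 * (2 * x - D * (2 * A)) * (x - D * (2 * A))
  = 2 * (G2 * (x - D * A)) * (x - D * (2 * A)) by ring.
by rewrite IH; ring.
Qed.

Lemma geom_poly_root d k : (k < d)%N -> (geom_poly D d).[D * 2 ^+ k.+1] = 0.
Proof.
move=> kd; apply/eqP; rewrite /geom_poly horner_prod prodf_seq_eq0.
apply/hasP; exists (Ordinal kd); first exact: mem_index_enum.
by rewrite /= hornerXsubC subrr.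
Qed.

Lemma geom_poly_neq0 d x : (forall k, (k < d)%N -> x != D * 2 ^+ k.+1) ->
  (geom_poly D d).[x] != 0.
Proof.
move=> h; rewrite /geom_poly horner_prod; apply/prodf_neq0 => i _.
by rewrite hornerXsubC subr_eq0 h.
Qed.

Lemma size_geom_poly d : size (geom_poly D d) = d.+1.
Proof.
by rewrite size_prod_XsubC [index_enum _]unlock -enumT size_enum_ord.
Qed.

Hypothesis D0 : 0 < D.

Lemma ltr_geom j k : (D * 2 ^+ j < D * 2 ^+ k) = (j < k)%N.
Proof. by rewrite ltr_pM2l // ltr_eXn2l // ltr1n. Qed.

Lemma ler_geom j k : (D * 2 ^+ j <= D * 2 ^+ k) = (j <= k)%N.
Proof. by rewrite ler_pM2l // ler_eXn2l // ltr1n. Qed.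

Lemma geom_poly_gap_neq0 d k x : D * 2 ^+ k < x < D * 2 ^+ k.+1 ->
  (geom_poly D d).[x] != 0.
Proof.
move=> /andP[lo hi]; apply: geom_poly_neq0 => i _; apply/eqP => xE.
by move: lo hi; rewrite xE !ltr_geom ltnS ltnS leqNgt => /negbTE ->.
Qed.

Lemma geom_poly_separable d : separable_poly (geom_poly D d).
Proof.
rewrite /geom_poly.
rewrite -(big_map (fun i : 'I_d => D * 2 ^+ i.+1) xpredT (fun u => 'X - u%:P)).
rewrite separable_prod_XsubC map_inj_uniq ?index_enum_uniq //.
move=> i j E; apply/val_inj/eqP.
by rewrite eqn_leq -ltnS -[X in _ && X]ltnS -!ler_geom E lexx.
Qed.
End GeomPoly.

Section Doubling.
Variables (R : realFieldType) (h : R -> R) (lo : R) (n : nat) (m : nat -> R).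
Hypothesis h_doubling : forall k x, (k.+1 < n)%N ->
  lo * 2 ^+ k < x < lo * 2 ^+ k.+1 -> h x < h (2 * x).
Hypothesis m_gap : forall k, (k < n)%N -> lo * 2 ^+ k < m k < lo * 2 ^+ k.+1.

Let increasing : (forall k, (k.+1 < n)%N -> h (m k) < h (m k.+1)) ->
  forall j k, (j < k)%N -> (k < n)%N -> h (m j) < h (m k).
Proof.
move=> step j; elim=> // k IH; rewrite ltnS leq_eqVlt => /orP[/eqP->|jk] kn.
  exact: step.
by apply: lt_trans (step k kn); apply: IH => //; apply: ltnW.
Qed.

(** Doubling carries each gap onto the next one, so twice the maximizer competes with the maximizer
    of the next gap. *)
Lemma gap_max_increasing :
  (forall k x, (k < n)%N -> lo * 2 ^+ k < x < lo * 2 ^+ k.+1 -> h x <= h (m k)) ->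
  forall j k, (j < k)%N -> (k < n)%N -> h (m j) < h (m k).
Proof.
move=> hmax; apply: increasing => k kn.
have mk := m_gap (ltnW kn); apply: lt_le_trans (h_doubling kn mk) _.
apply: hmax => //; move: mk; rewrite [lo * 2 ^+ k.+2]mulrC [lo * 2 ^+ k.+1]mulrC.
by rewrite !exprS -!mulrA ![_ * lo]mulrC !ltr_pM2l.
Qed.

(** Here the comparison runs backwards: half the minimizer of the next gap competes in the present
    gap. *)
Lemma gap_min_increasing :
  (forall k x, (k < n)%N -> lo * 2 ^+ k < x < lo * 2 ^+ k.+1 -> h (m k) <= h x) ->
  forall j k, (j < k)%N -> (k < n)%N -> h (m j) < h (m k).
Proof.
move=> hmin; apply: increasing => k kn.
have hg : lo * 2 ^+ k < m k.+1 / 2 < lo * 2 ^+ k.+1.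
  have := m_gap kn; rewrite ltr_pdivlMr // ltr_pdivrMr //.
  by rewrite !exprSr !mulrA.
apply: le_lt_trans (hmin _ _ (ltnW kn) hg) _.
by have := h_doubling kn hg; rewrite mulrCA divff ?mulr1 // pnatr_eq0.
Qed.
End Doubling.

Lemma geom_poly_le (R : realFieldType) (D : R) d (M x : R) :
  (forall k, (k < d)%N -> `|x - D * 2 ^+ k.+1| <= M) ->
  `|(geom_poly D d).[x]| <= M ^+ d.
Proof.
move=> h; rewrite /geom_poly horner_prod normr_prod.
rewrite -[d in leRHS]card_ord -prodr_const.
by apply: ler_prod => i _; rewrite normr_ge0 hornerXsubC h.
Qed.

Lemma geom_poly_ge (R : realFieldType) (D : R) d (M x : R) : 0 <= M ->
  (forall k, (k < d)%N -> M <= `|x - D * 2 ^+ k.+1|) ->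
  M ^+ d <= `|(geom_poly D d).[x]|.
Proof.
move=> M0 h; rewrite /geom_poly horner_prod normr_prod.
rewrite -[d in leLHS]card_ord -prodr_const.
by apply: ler_prod => i _; rewrite M0 hornerXsubC h.
Qed.

Lemma choice_below (T : nmodType) (n : nat) (Pr : nat -> T -> Prop) :
  (forall k, (k < n)%N -> exists m, Pr k m) ->
  exists m : nat -> T, forall k, (k < n)%N -> Pr k (m k).
Proof.
move=> h; have /boolp.choice[m hm] : forall k, exists m, (k < n)%N -> Pr k m.
  move=> k; have [/h[m hm]|_] := ltnP k n; first by exists m.
  (* Indices from [n] on receive the default value 0, which is why [T] must have a zero. *)
  by exists 0.
by exists m.
Qed.

(** * Extremal values of the quotient of two such polynomials *)

Section TwoGeomPolys.
Variables (R : realType) (n : nat).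
Let d := n.+1.
Let A : R := 2 ^+ d.
(** The cube makes [A^2 < D], the separation of roots and poles on which the comparison
    [f_zero_lt_pole] rests. *)
Let D : R := A ^+ 3.
Let P : {poly R} := geom_poly 1 d.
Let Q : {poly R} := geom_poly D d.
Let f x := P.[x] / Q.[x].

Let A2 : 2 <= A.
Proof. by rewrite /A -[leLHS]expr1 ler_eXn2l // ltr1n. Qed.

Let A2D : A ^+ 2 * 2 <= D.
Proof. by rewrite /D [A ^+ 3]exprSr ler_pM2l ?exprn_gt0. Qed.

Let AD : 2 * A <= D.
Proof. by move: A2 A2D; rewrite expr2; nra. Qed.

Let D0 : 0 < D. Proof. by move: A2 AD; lra. Qed.

Let powA k : (k < d)%N -> (2 : R) <= 2 ^+ k.+1 <= A.
Proof.
move=> kd; apply/andP; split; last by rewrite ler_eXn2l ?ltr1n.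
by rewrite -[leLHS]expr1 ler_eXn2l ?ltr1n.
Qed.

(** With a further gap to the right, the upper end is at most [lo 2^(n-1)], and
    [2^(n-1) = A / 4]. *)
Let gap (lo : R) k x : 0 < lo -> (k.+1 < n)%N ->
  lo * 2 ^+ k < x < lo * 2 ^+ k.+1 -> lo < x < lo * (A / 4).
Proof.
move=> lo0 kn /andP[h1 h2]; apply/andP; split.
  by apply: le_lt_trans h1; rewrite ler_pMr // exprn_ege1 // ler1n.
apply: lt_le_trans h2 _; rewrite ler_pM2l // ler_pdivlMr // -[4]/(2 * 2)%:R.
by rewrite natrM -expr2 -exprD ler_eXn2l ?ltr1n // addn2.
Qed.

(** By the doubling identity the growth factor is [A (x - 1) / (A - x)], which exceeds 1 in this
    range. *)
Let P_doubling x : 2 < x < A / 2 -> P.[x] != 0 -> `|P.[x]| < `|P.[2 * x]|.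
Proof.
move=> /andP[x2 xA]; rewrite -normr_gt0 => Px.
have := congr1 Num.norm (geom_poly_doubling 1 d x).
rewrite -/A !mul1r !normrM -/P [`|x - A|]ltr0_norm; last by lra.
rewrite [`|x - 1|]gtr0_norm ?[`|A|]gtr0_norm; try lra.
move=> E; rewrite ltNge; apply/negP => le.
have : `|P.[2 * x]| * - (x - A) <= `|P.[x]| * - (x - A).
  by rewrite ler_wpM2r //; lra.
rewrite E leNgt => /negP; apply.
by rewrite -mulrA mulrCA ltr_pM2l //; have := A2; nra.
Qed.

(** Dividing the doubling identities of [P] and [Q] cancels the factor [A] and leaves [f(2x) (x -
    A)(x - D) = f(x) (x - 1)(x - D A)]. *)
Let f_doubling x : P.[x] != 0 -> Q.[x] != 0 -> Q.[2 * x] != 0 ->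
  `|(x - A) * (x - D)| < `|(x - 1) * (x - D * A)| -> `|f x| < `|f (2 * x)|.
Proof.
move=> Px Qx Q2x lt.
have E : f (2 * x) * ((x - A) * (x - D)) = f x * ((x - 1) * (x - D * A)).
  have := geom_poly_doubling 1 d x; have := geom_poly_doubling D d x.
  rewrite -/P -/Q -/A !mul1r => QE PE.
  have A0 : A != 0 by rewrite lt0r_neq0 //; have := A2; lra.
  rewrite /f; apply: (mulfI (mulf_neq0 A0 (mulf_neq0 Qx Q2x))).
  transitivity (A * Q.[x] * (x - D) * (P.[2 * x] * (x - A))).
    by field; rewrite ?Qx ?Q2x.
  by rewrite PE -QE; field; rewrite ?Qx ?Q2x.
have fx : 0 < `|f x| by rewrite normr_gt0 mulf_neq0 ?invr_eq0.
have E' := congr1 Num.norm E; rewrite normrM [RHS]normrM in E'.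
rewrite ltNge; apply/negP => le.
have : `|f (2 * x)| * `|(x - A) * (x - D)| <= `|f x| * `|(x - A) * (x - D)|.
  by rewrite ler_wpM2r.
by rewrite E' leNgt => /negP; apply; rewrite ltr_pM2l.
Qed.

Let Q_neq0 x : 0 <= x -> x <= A -> Q.[x] != 0.
Proof.
move=> x0 xA; apply: geom_poly_neq0 => k /powA/andP[h _].
apply/eqP => xE; have : D * 2 <= D * 2 ^+ k.+1 by rewrite ler_pM2l.
by rewrite -xE; move: A2 AD; lra.
Qed.

Let P_neq0 x : 2 * D <= x -> P.[x] != 0.
Proof.
move=> xD; apply: geom_poly_neq0 => k /powA/andP[_ h].
by apply/eqP; rewrite mul1r => xE; move: xD; rewrite xE; move: A2 AD; lra.
Qed.

Let f_doubling1 x : 2 < x < A / 2 -> P.[x] != 0 -> `|f x| < `|f (2 * x)|.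
Proof.
move=> /andP[x2 xA] Px; have hA := A2; have hD := AD.
apply: f_doubling; rewrite ?Q_neq0 //; try lra.
have xDA : x < D * A by nra.
have p1 : 0 < (x - A) * (x - D) by rewrite nmulr_rgt0; lra.
have p2 : (x - 1) * (x - D * A) < 0 by rewrite pmulr_rlt0; lra.
rewrite (gtr0_norm p1) (ltr0_norm p2); nra.
Qed.

Let f_doubling2 x : 2 * D < x < 2 * D * (A / 4) ->
  Q.[x] != 0 -> Q.[2 * x] != 0 -> `|f x| < `|f (2 * x)|.
Proof.
move=> /andP[x2 xA] Qx Q2x; have hA := A2; have hD := AD.
apply: f_doubling => //; rewrite ?P_neq0 //; try lra.
have xDA : 2 * x < D * A by lra.
have p1 : 0 < (x - A) * (x - D) by rewrite pmulr_rgt0; lra.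
have p2 : (x - 1) * (x - D * A) < 0 by rewrite pmulr_rlt0; lra.
(* The product [(x - 1) x] lies between the two sides: the second comparison uses [2 x < D A]. *)
have lt1 : (x - A) * (x - D) < (x - 1) * x by apply: ltr_pM; lra.
have : (x - 1) * x <= (x - 1) * (D * A - x) by rewrite ler_pM2l; lra.
rewrite (gtr0_norm p1) (ltr0_norm p2); lra.
Qed.
Let zero_gap k : (k < n)%N -> exists m, [/\ 2 * 2 ^+ k < m < 2 * 2 ^+ k.+1,
  (forall x, 2 * 2 ^+ k < x < 2 * 2 ^+ k.+1 -> `|f x| <= `|f m|)
  & stable_contact P Q (- f m)].
Proof.
move=> kn; have kd : (k.+1 < d)%N by [].
have [||||x /andP[x0 xA]|m [mab mmax mc]] :=
    @zero_gap_contact R P Q (2 * 2 ^+ k) (2 * 2 ^+ k.+1).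
- by rewrite mulr_gt0 ?exprn_gt0 //= ltr_geom.
- by rewrite -exprS -[2 ^+ _]mul1r geom_poly_root // ltnW.
- by rewrite -exprS -[2 ^+ _]mul1r geom_poly_root.
- move=> x; rewrite -!exprS -[2 ^+ k.+1]mul1r -[2 ^+ k.+2]mul1r.
  exact: geom_poly_gap_neq0.
- apply: Q_neq0; first by apply: le_trans x0; rewrite mulr_ge0 ?exprn_ge0.
  apply: le_trans xA _; rewrite -exprS; exact: (andP (powA kd)).2.
exists m; split=> // x /andP[? ?]; apply: mmax; by rewrite !ltW.
Qed.

Let pole_gap k : (k < n)%N ->
  exists m, [/\ 2 * D * 2 ^+ k < m < 2 * D * 2 ^+ k.+1,
  (forall x, 2 * D * 2 ^+ k < x < 2 * D * 2 ^+ k.+1 -> `|f m| <= `|f x|)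
  & stable_contact P Q (- f m)].
Proof.
move=> kn; have kd : (k.+1 < d)%N by [].
have E j : 2 * D * 2 ^+ j = D * 2 ^+ j.+1 by rewrite exprS; ring.
have [||||x /andP[x0 _]|m [mab mmax mc]] :=
    @pole_gap_contact R P Q (2 * D * 2 ^+ k) (2 * D * 2 ^+ k.+1).
- by rewrite !E mulr_gt0 ?exprn_gt0 //= ltr_geom.
- by rewrite E geom_poly_root // ltnW.
- by rewrite E geom_poly_root.
- by move=> x; rewrite !E; apply: geom_poly_gap_neq0.
- apply: P_neq0; apply: le_trans x0; rewrite ler_pMr; last by rewrite pmulr_rgt0.
  by rewrite exprn_ege1 // ler1n.
by exists m.
Qed.

(** With the constant 1 in place of [Q], a contact is a critical point of [P], so the argument for
    gaps between zeros applies again. *)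
Let crit_gap k : (k < n)%N -> exists m, [/\ 2 * 2 ^+ k < m < 2 * 2 ^+ k.+1,
  (forall x, 2 * 2 ^+ k < x < 2 * 2 ^+ k.+1 -> `|P.[x]| <= `|P.[m]|)
  & stable_contact P 1 (- P.[m])].
Proof.
move=> kn; have kd : (k.+1 < d)%N by [].
have [||||x _|m [mab mmax mc]] :=
    @zero_gap_contact R P 1 (2 * 2 ^+ k) (2 * 2 ^+ k.+1).
- by rewrite mulr_gt0 ?exprn_gt0 //= ltr_geom.
- by rewrite -exprS -[2 ^+ _]mul1r geom_poly_root // ltnW.
- by rewrite -exprS -[2 ^+ _]mul1r geom_poly_root.
- move=> x; rewrite -!exprS -[2 ^+ k.+1]mul1r -[2 ^+ k.+2]mul1r.
  exact: geom_poly_gap_neq0.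
- by rewrite hornerC oner_eq0.
rewrite hornerC divr1 in mc; exists m; split=> // x /andP[? ?].
by have := mmax x; rewrite !hornerC !divr1; apply; rewrite !ltW.
Qed.
Let gap_in (lo : R) k x : 0 < lo -> (k < n)%N ->
  lo * 2 ^+ k < x < lo * 2 ^+ k.+1 -> lo <= x <= lo * A.
Proof.
move=> lo0 kn /andP[h1 h2]; apply/andP; split.
  by apply/ltW/(le_lt_trans _ h1); rewrite ler_pMr // exprn_ege1 // ler1n.
apply/ltW/(lt_le_trans h2); rewrite ler_pM2l //; exact: (andP (powA (leqW kn))).2.
Qed.

(** In absolute value, the factors of [P(x)] are at most [A] and those of [Q(x)] at least [D], while
    those of [P(y)] are at least [D] and those of [Q(y)] at most [D A]. The claim reduces to
    [A (D A) < D^2]. *)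
Let f_zero_lt_pole x y : 0 <= x <= A -> 2 * D <= y <= D * A ->
  Q.[x] != 0 -> Q.[y] != 0 -> `|f x| < `|f y|.
Proof.
move=> /andP[x0 xA] /andP[yD yDA] Qx Qy; have hA := A2; have hD := AD.
have Px : `|P.[x]| <= A ^+ d.
  apply: geom_poly_le => k /powA/andP[? ?]; rewrite mul1r ler_norml.
  by apply/andP; split; lra.
have Py : D ^+ d <= `|P.[y]|.
  apply: geom_poly_ge => [|k /powA/andP[? ?]]; first exact: ltW.
  by rewrite mul1r ger0_norm; lra.
have Qy' : `|Q.[y]| <= (D * A) ^+ d.
  apply: geom_poly_le => k /powA/andP[k2 kA]; rewrite ler_norml.
  have : D * 2 ^+ k.+1 <= D * A by rewrite ler_pM2l.
  have : D * 2 <= D * 2 ^+ k.+1 by rewrite ler_pM2l.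
  by move=> *; apply/andP; split; lra.
have Qx' : D ^+ d <= `|Q.[x]|.
  apply: geom_poly_ge => [|k /powA/andP[k2 kA]]; first exact: ltW.
  have : D * 2 <= D * 2 ^+ k.+1 by rewrite ler_pM2l.
  by move=> *; rewrite ler0_norm; lra.
rewrite /f !normrM !normfV ltr_pdivrMr ?normr_gt0 // mulrAC.
rewrite ltr_pdivlMr ?normr_gt0 //.
apply: (@le_lt_trans _ _ (A ^+ d * (D * A) ^+ d)); first by rewrite ler_pM.
apply: (@lt_le_trans _ _ (D ^+ d * D ^+ d)); last first.
  by rewrite ler_pM // exprn_ge0 // ltW.
have D0' := ltW D0; have A0 : 0 <= A by lra.
rewrite -[ltLHS]exprMn -[ltRHS]exprMn ltr_pXn2r ?nnegrE ?mulr_ge0 //.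
have -> : A * (D * A) = D * (A ^+ 2) by ring.
by rewrite ltr_pM2l //; apply: lt_le_trans A2D; nra.
Qed.

Let two0 : (0 : R) < 2. Proof. by []. Qed.
Let D2 : 0 < 2 * D. Proof. by rewrite pmulr_rgt0. Qed.

Let P_gap_neq0 k x : 2 * 2 ^+ k < x < 2 * 2 ^+ k.+1 -> P.[x] != 0.
Proof.
move=> xk; apply: (@geom_poly_gap_neq0 _ _ ltr01 _ k.+1).
by move: xk; rewrite !mul1r -!exprS.
Qed.

Let Q_gap_neq0 k x : 2 * D * 2 ^+ k < x < 2 * D * 2 ^+ k.+1 -> Q.[x] != 0.
Proof.
move=> xk; apply: (@geom_poly_gap_neq0 _ _ D0 _ k.+1).
by move: xk; rewrite [2 * D]mulrC -!mulrA -!exprS.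
Qed.

Let zero_doubling k x : (k.+1 < n)%N -> 2 * 2 ^+ k < x < 2 * 2 ^+ k.+1 ->
  [/\ P.[x] != 0 & 2 < x < A / 2].
Proof.
move=> kn xk; split; first exact: P_gap_neq0 xk.
have /andP[-> lt] := gap two0 kn xk; lra.
Qed.

(** The boolean is true for gaps between poles. Within one kind of gap the values are distinct by
    strict growth of [|f|], and across the two kinds by [f_zero_lt_pole]. *)
Lemma geom_pencil_contacts : exists t : bool * 'I_n -> R,
  injective t /\ forall j, stable_contact P Q (t j).
Proof.
have [mz hz] := choice_below zero_gap; have [mp hp] := choice_below pole_gap.
have hA := A2.
have mz_in k : (k < n)%N -> 0 <= mz k <= A.
  move=> kn; have [lt _ _] := hz k kn; have /andP[? _] := gap_in two0 kn lt.
  case/andP: lt => _ lt; apply/andP; split; first by lra.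
  by apply/ltW/(lt_le_trans lt); rewrite -exprS; exact: (andP (powA (k := k.+1) kn)).2.
have mp_in k : (k < n)%N -> 2 * D <= mp k <= D * A.
  move=> kn; have [lt _ _] := hp k kn; have /andP[-> _] := gap_in D2 kn lt.
  case/andP: lt => _ lt; apply/ltW/(lt_le_trans lt); rewrite -mulrA mulrCA -exprS.
  by rewrite ler_pM2l //; exact: (andP (powA (k := k.+1) kn)).2.
have zinc j k : (j < k)%N -> (k < n)%N -> `|f (mz j)| < `|f (mz k)|.
  apply: (@gap_max_increasing R (fun x => `|f x|) 2) => {j k} [k x kn|k|k x].
  - by move=> /(zero_doubling kn)[Px xb]; apply: f_doubling1.
  - by case/hz.
  - by case/hz=> _ h _; apply: h.
have pinc j k : (j < k)%N -> (k < n)%N -> `|f (mp j)| < `|f (mp k)|.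
  apply: (@gap_min_increasing R (fun x => `|f x|) (2 * D)) => {j k} [k x kn xk|k|k x].
  - apply: f_doubling2; [exact: gap D2 kn xk|exact: Q_gap_neq0 xk|].
    apply: (Q_gap_neq0 (k := k.+1)); case/andP: xk => ? ?.
    have E j : 2 * D * 2 ^+ j.+1 = 2 * (2 * D * 2 ^+ j) by rewrite exprS; ring.
    by apply/andP; split; [rewrite (E k)|rewrite (E k.+1)]; rewrite ltr_pM2l.
  - by case/hp.
  - by case/hp=> _ h _; apply: h.
have zp j k : (j < n)%N -> (k < n)%N -> `|f (mz j)| < `|f (mp k)|.
  move=> jn kn; have [lt _ _] := hp k kn; have /andP[z0 zA] := mz_in j jn.
  by apply: (f_zero_lt_pole (mz_in j jn) (mp_in k kn) (Q_neq0 z0 zA)); exact: Q_gap_neq0 lt.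
exists (fun j : bool * 'I_n => if j.1 then - f (mp j.2) else - f (mz j.2)); split; last first.
  by move=> [[] j] /=; [have [] := hp j (ltn_ord j)|have [] := hz j (ltn_ord j)].
have inj (m : nat -> R) : (forall j k, (j < k)%N -> (k < n)%N -> `|f (m j)| < `|f (m k)|) ->
    forall j k : 'I_n, f (m j) = f (m k) -> j = k.
  move=> inc j k E; apply/val_inj; case: (ltngtP j k) => // jk.
    by have := inc _ _ jk (ltn_ord k); rewrite E ltxx.
  by have := inc _ _ jk (ltn_ord j); rewrite E ltxx.
move=> [[] j] [[] k] /= /oppr_inj E.
- by rewrite (inj _ pinc _ _ E).
- by have := zp _ _ (ltn_ord k) (ltn_ord j); rewrite E ltxx.
- by have := zp _ _ (ltn_ord j) (ltn_ord k); rewrite E ltxx.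
- by rewrite (inj _ zinc _ _ E).
Qed.

Lemma geom_poly_critical_points : exists y : 'I_n -> R,
  (forall k, 0 < y k /\ P^`().[y k] = 0) /\ injective (fun k => P.[y k]).
Proof.
have [m hm] := choice_below crit_gap.
have inc j k : (j < k)%N -> (k < n)%N -> `|P.[m j]| < `|P.[m k]|.
  apply: (@gap_max_increasing R (fun x => `|P.[x]|) 2) => {j k} [k x kn|k|k x].
  - by move=> /(zero_doubling kn)[Px xb]; apply: P_doubling.
  - by case/hm.
  - by case/hm=> _ h _; apply: h.
(* A double root of [P - P.[m k]] is a critical point of [P]. *)
have /boolp.choice[y hy] : forall k : 'I_n,
    exists y, [/\ 0 < y, P^`().[y] = 0 & P.[y] = P.[m k]].
  move=> k; have [_ _ [T [K [eta [_ eta0 _ TK Tc]]]]] := hm k (ltn_ord k).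
  have /Tc[y y0 [Py dPy]] : `|0 : R| < eta by rewrite normr0.
  have : `|T 0 - - P.[m k]| <= 0 by have := TK 0; rewrite normr0 mulr0.
  rewrite normr_le0 opprK addr_eq0 => /eqP T0.
  exists y; split=> //.
    by move: dPy; rewrite T0 addr0 alg_polyC derivD derivC addr0.
  move: Py; rewrite T0 addr0 alg_polyC hornerD hornerC => /eqP.
  by rewrite subr_eq0 => /eqP.
exists y; split=> [k|j k]; first by have [] := hy k.
have [_ _ ->] := hy j; have [_ _ ->] := hy k => E.
apply/val_inj; case: (ltngtP j k) => // jk.
  by have := inc _ _ jk (ltn_ord k); rewrite E ltxx.
by have := inc _ _ jk (ltn_ord j); rewrite E ltxx.
Qed.

(** At the first two zeros [x = 2 D] and [2 x] of [Q], equal values [p] of [P] would turn the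
    doubling identity into [p x (A - 1) = 0]. This separation later makes the pencil independent and
    its singular members finite in number. *)
Lemma geom_poly_separates : (0 < n)%N ->
  exists e1 e2, [/\ Q.[e1] = 0, Q.[e2] = 0 & P.[e1] != P.[e2]].
Proof.
move=> n0; exists (D * 2 ^+ 1), (D * 2 ^+ 2); rewrite !geom_poly_root //; split=> //.
have hA := A2; have hD := D0.
have -> : D * 2 ^+ 2 = 2 * (D * 2 ^+ 1) by ring.
have x0 : 2 * D <= D * 2 ^+ 1 by rewrite expr1 mulrC.
have p0 := P_neq0 x0; have := geom_poly_doubling 1 d (D * 2 ^+ 1).
rewrite -/P -/A !mul1r => E; apply/eqP => PE; move: E; rewrite -PE.
move: (D * 2 ^+ 1) x0 p0 {PE} => x x0 p0 E; move: P.[x] p0 E => p p0 E.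
have : p * (x * (A - 1)) = 0.
  by transitivity (A * p * (x - 1) - p * (x - A)); [ring|rewrite -E subrr].
by apply/eqP; rewrite !mulf_neq0 //; apply: lt0r_neq0; lra.
Qed.
End TwoGeomPolys.

Lemma univariate_pencil (R : realType) (d : nat) : (1 < d)%N ->
  exists P Q : {poly R},
  [/\ size P = d.+1 /\ size Q = d.+1, separable_poly Q,
      exists e1 e2, [/\ Q.[e1] = 0, Q.[e2] = 0 & P.[e1] != P.[e2]],
      exists t : bool * 'I_d.-1 -> R,
        injective t /\ forall j, stable_contact P Q (t j)
    & exists y : 'I_d.-1 -> R,
        (forall k, 0 < y k /\ P^`().[y k] = 0) /\ injective (fun k => P.[y k])].
Proof.
case: d => [//|n] n0; exists (geom_poly 1 n.+1), (geom_poly ((2 ^+ n.+1) ^+ 3) n.+1).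
split.
- by rewrite !size_geom_poly.
- by apply: geom_poly_separable; rewrite !exprn_gt0.
- exact: geom_poly_separates.
- exact: geom_pencil_contacts.
- exact: geom_poly_critical_points.
Qed.

(** * Choice of the small parameters [lam] and [eps] *)

Lemma finite_lower_bound (R : realFieldType) (T : finType) (g : T -> R) :
  (forall i, 0 < g i) -> exists2 e : R, 0 < e & forall i, e <= g i.
Proof.
move=> g0; have [e e0 he] : exists2 e : R, 0 < e & forall i, i \in enum T -> e <= g i.
  elim: (enum T) => [|i s [e e0 IH]]; first by exists 1.
  exists (Num.min e (g i)) => [|j]; first by rewrite lt_min e0 g0.
  by rewrite inE ge_min => /orP[/eqP->|/IH->//]; rewrite lexx orbT.
by exists e => // i; apply: he; rewrite mem_enum.
Qed.

(** A collision with distinct second indices makes a positive [lam] equal to a quotient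
    [|v k - v k'| / |v l - v l'|]. Half a positive lower bound of these finitely many nonzero
    quotients avoids them all. *)
Lemma generic_sum_injective (R : realFieldType) (K : finType) (v : K -> R) :
  injective v -> exists2 lam : R, lam != 0 & injective (fun k => v k.1 + lam * v k.2).
Proof.
move=> vI.
pose g (i : (K * K) * (K * K)) := if (i.1.1 != i.1.2) && (i.2.1 != i.2.2)
  then `|v i.1.1 - v i.1.2| / `|v i.2.1 - v i.2.2| else 1.
have neq k l : k != l -> 0 < `|v k - v l|.
  by move=> kl; rewrite normr_gt0 subr_eq0 (inj_eq vI).
have [|e e0 he] := @finite_lower_bound R _ g.
  by move=> i; rewrite /g; case: ifP => // /andP[? ?]; rewrite divr_gt0 ?neq.
have e2 : e / 2 != 0 by rewrite lt0r_neq0 // divr_gt0.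
exists (e / 2) => //.
move=> [k l] [k' l'] /= E.
have [ll|ll] := eqVneq l l'.
  by move: E; rewrite ll => /addIr/vI->.
have [kk|kk] := eqVneq k k'.
  move: E; rewrite kk => /addrI/(mulfI e2)/vI.
  by move=> E; rewrite E eqxx in ll.
have := he ((k, k'), (l, l')); rewrite /g /= kk ll ler_pdivlMr ?neq //.
have -> : v k - v k' = - (e / 2 * (v l - v l')) by lra.
rewrite normrN normrM gtr0_norm ?divr_gt0 // => h.
by move: h; rewrite ler_pM2r ?neq // leNgt ltr_pdivrMr // ltr_pMr // ltr1n.
Qed.

(** For small [eps] the parameter continuing [t j] stays closer to [t j] than half the distance to
    any other [t j'], so different [j] cannot collide. For the same [j], injectivity in [c] and of
    [w] suffices. *)
Lemma stable_contact_members (R : realType) (P Q : {poly R}) (J K : finType)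
    (t : J -> R) (w : K -> R) :
  injective t -> (forall j, stable_contact P Q (t j)) -> injective w ->
  exists2 eps : R, eps != 0 & exists T : J * K -> R, injective T /\
    forall jk, exists2 x : R, 0 < x &
      double_root (P + (eps * w jk.2)%:P + T jk *: Q) x.
Proof.
move=> tI tst wI.
have /boolp.choice[D hD] : forall j, exists D : (R -> R) * R * R,
    [/\ 0 < D.1.2, 0 < D.2, injective D.1.1,
      (forall c : R, `|D.1.1 c - t j| <= D.1.2 * `|c|)
    & forall c : R, `|c| < D.2 ->
        exists2 x : R, 0 < x & double_root (P + c%:P + D.1.1 c *: Q) x].
  by move=> j; have [T [K0 [eta h]]] := tst j; exists (T, K0, eta).
(* The first bound puts [eps * w k] in the range of validity [eta] of each contact, the second gives
   the half distances. Using [1 + |w k|] avoids division by 0 and makes the estimates strict. *)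
pose g (i : (J * J) * K) := Num.min ((D i.1.1).2 / (1 + `|w i.2|))
  (if i.1.1 != i.1.2 then `|t i.1.1 - t i.1.2| / (2 * (D i.1.1).1.2 * (1 + `|w i.2|))
   else 1).
have w0 k : 0 < 1 + `|w k| by rewrite ltr_wpDr.
have [|e e0 he] := @finite_lower_bound R _ g.
  move=> i; have [K0 eta0 _ _ _] := hD i.1.1; rewrite /g lt_min divr_gt0 //=.
  case: ifP => // ij; rewrite divr_gt0 ?mulr_gt0 // normr_gt0 subr_eq0.
  by rewrite (inj_eq tI).
have ew k : `|e * w k| < e * (1 + `|w k|).
  by rewrite normrM gtr0_norm // ltr_pM2l // ltrDr.
exists e; first exact: lt0r_neq0.
exists (fun jk => (D jk.1).1.1 (e * w jk.2)); split=> [[j k] [j' k'] /= E|[j k] /=].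
  have [jj|jj] := eqVneq j j'.
    move: E; rewrite jj; have [_ _ TI _ _] := hD j'.
    by move=> /TI/(mulfI (lt0r_neq0 e0))/wI->.
  have far i i' l : i != i' ->
      `|(D i).1.1 (e * w l) - t i| < `|t i - t i'| / 2.
    move=> ii; have [K0 _ _ TK _] := hD i; apply: le_lt_trans (TK _) _.
    have := he ((i, i'), l); rewrite /g /= ii le_min => /andP[_].
    rewrite ler_pdivlMr ?mulr_gt0 // => h; have h' := ew l.
    rewrite ltr_pdivlMr //; apply: lt_le_trans h.
    have -> : e * (2 * (D i).1.2 * (1 + `|w l|)) = (D i).1.2 * (e * (1 + `|w l|)) * 2.
      by ring.
    by rewrite ltr_pM2r // ltr_pM2l.
  have h1 := far j j' k jj; have := far j' j k'; rewrite eq_sym jj => /(_ isT).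
  rewrite -E (distrC (t j')) => h2.
  have := ler_distD ((D j).1.1 (e * w k)) (t j) (t j').
  rewrite (distrC (t j) ((D j).1.1 _)) => h3.
  by have := le_lt_trans h3 (ltrD h1 h2); rewrite -splitr ltxx.
have [_ _ _ _ Tc] := hD j; apply: Tc; apply: lt_le_trans (ew k) _.
have := he ((j, j), k); rewrite /g /= le_min => /andP[h _].
by rewrite -ler_pdivlMr.
Qed.

From mathcomp Require Import mpoly complex.
Require Import Defs.
Local Open Scope ring_scope.
Local Open Scope complex_scope.

(** * Univariate polynomials in one of several variables, and their separated sums *)

Definition univariate (R : comNzRingType) (n : nat) (i : 'I_n) (p : {poly R}) :
    {mpoly R[n]} :=
  (map_poly (@mpolyC n R) p).['X_i].

Section Univariate.
Variables (R : comNzRingType) (n : nat).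
Implicit Types (p q : {poly R}) (i j : 'I_n) (v : 'I_n -> R).

Lemma univariateD i p q : univariate i (p + q) = univariate i p + univariate i q.
Proof. by rewrite /univariate rmorphD hornerD. Qed.

Lemma univariate0 i : univariate i (0 : {poly R}) = 0.
Proof. by rewrite /univariate rmorph0 horner0. Qed.

Lemma univariateM i p q : univariate i (p * q) = univariate i p * univariate i q.
Proof. by rewrite /univariate rmorphM hornerM. Qed.

Lemma univariateX i : univariate i ('X : {poly R}) = 'X_i.
Proof. by rewrite /univariate map_polyX hornerX. Qed.

Lemma univariateC i (c : R) : univariate i c%:P = c%:MP.
Proof. by rewrite /univariate map_polyC hornerC. Qed.

Lemma meval_univariate v i p : (univariate i p).@[v] = p.[v i].
Proof.
elim/poly_ind: p => [|p c IH]; first by rewrite -polyC0 univariateC mevalC hornerC.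
rewrite univariateD univariateM univariateX univariateC mevalD mevalM mevalXU.
by rewrite mevalC IH !hornerE.
Qed.

Lemma mderiv_univariate i j p :
  (univariate i p)^`M(j) = if i == j then univariate i p^`() else 0.
Proof.
elim/poly_ind: p => [|p c IH].
  by rewrite -polyC0 univariateC mderivC derivC univariateC if_same.
rewrite univariateD univariateM univariateX univariateC mderivD mderivM mderivC IH.
rewrite mderivX mnm1E addr0 derivD derivC addr0 derivM derivX mulr1; have [<-|ij] := eqVneq i j.
  have -> : (U_(i) - U_(i) = 0 :> 'X_{1..n})%MM.
    by apply/mnmP => k; rewrite mnmBE subnn mnm0E.
  by rewrite univariateD univariateM univariateX mpolyX0 scale1r mulr1.
by rewrite scale0r mul0r mulr0 addr0.
Qed.

Lemma msupp_univariate i p m : m \in msupp (univariate i p) -> (mdeg m < size p)%N.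
Proof.
move=> /msize_mdeg_lt /leq_trans; apply.
rewrite /univariate horner_coef; apply: leq_trans (msize_sum _ _ _) _.
apply/bigmax_leqP => k _; rewrite coef_map mul_mpolyC mpolyXn.
apply: leq_trans (msizeZ_le _ _) _; rewrite msizeX mdegMn mdeg1 mul1n.
apply: leq_trans (ltn_ord k) _; rewrite map_polyE.
by apply: leq_trans (size_Poly _) _; rewrite size_map.
Qed.
End Univariate.

Lemma map_univariate (R S : comNzRingType) (f : {rmorphism R -> S}) (n : nat)
    (i : 'I_n) (p : {poly R}) :
  map_mpoly f (univariate i p) = univariate i (map_poly f p).
Proof.
elim/poly_ind: p => [|p c IH].
  by rewrite !(univariate0, rmorph0).
rewrite univariateD univariateM univariateX univariateC !rmorphD !rmorphM /= IH.
rewrite univariateD univariateM map_polyX univariateX map_polyC univariateC.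
by rewrite map_mpolyX map_mpolyC.
Qed.

Definition separated (R : comNzRingType) (p : {poly R}) (a b : R) : {mpoly R[3]} :=
  univariate 0 p + a *: univariate 1 p + b *: univariate 2 p.

Section Separated.
Variables (R : comNzRingType) (P Q : {poly R}) (a b s t : R) (v : 'I_3 -> R).
Let p := s *: separated P a b + t *: univariate 0 Q.

Lemma meval_separated :
  p.@[v] = s * (P.[v 0] + a * P.[v 1] + b * P.[v 2]) + t * Q.[v 0].
Proof. by rewrite /p /separated !(mevalD, mevalZ, meval_univariate). Qed.

Lemma mderiv0_separated : p^`M(0).@[v] = s * P^`().[v 0] + t * Q^`().[v 0].
Proof.
rewrite /p /separated !(mderivD, mderivZ, mderiv_univariate) /= !scaler0 !addr0.
by rewrite !(mevalD, mevalZ, meval_univariate).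
Qed.

Lemma mderiv1_separated : p^`M(1).@[v] = s * (a * P^`().[v 1]).
Proof.
rewrite /p /separated !(mderivD, mderivZ, mderiv_univariate) /= !scaler0 !addr0 add0r.
by rewrite !(mevalD, mevalZ, meval_univariate).
Qed.

Lemma mderiv2_separated : p^`M(2).@[v] = s * (b * P^`().[v 2]).
Proof.
rewrite /p /separated !(mderivD, mderivZ, mderiv_univariate) /= !scaler0 !addr0 add0r.
by rewrite !(mevalD, mevalZ, meval_univariate).
Qed.
End Separated.

Lemma ord3_cases (i : 'I_3) : [\/ i = 0, i = 1 | i = 2].
Proof.
by case: i => [[|[|[|//]]] lt]; [constructor 1|constructor 2|constructor 3];
  apply: val_inj.
Qed.

(** * Finiteness of the singular members over a closed field *)

Lemma finite_roots (F : closedFieldType) (p : {poly F}) : p != 0 ->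
  exists s : seq F, forall x, p.[x] = 0 -> x \in s.
Proof.
move=> p0; have [s pE] := closed_field_poly_normal p; exists s => x /eqP px.
by rewrite -root_prod_XsubC -(rootZ _ _ (_ : lead_coef p != 0)) -?pE ?lead_coef_eq0.
Qed.

Section FinitelyManySingular.
Variables (F : closedFieldType) (P Q : {poly F}) (e1 e2 : F).
Hypotheses (dP0 : P^`() != 0) (sepQ : separable_poly Q).
Hypotheses (Qe1 : Q.[e1] = 0) (Qe2 : Q.[e2] = 0) (Pe12 : P.[e1] != P.[e2]).

Let simple_root x : Q.[x] = 0 -> Q^`().[x] != 0.
Proof.
move=> Qx; apply: (@coprimep_root _ Q).
  by move: sepQ; rewrite separable_poly.unlock.
exact/eqP.
Qed.

(* A double root of [P + c + t Q] is a root of the Wronskian-like polynomial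
   [P' Q - (P + c) Q'], which is nonzero because [P] takes two values on the
   zeros of [Q]. *)
Lemma finite_double_root_members c :
  exists s : seq F, forall t x, double_root (P + c%:P + t *: Q) x -> t \in s.
Proof.
pose W := P^`() * Q - (P + c%:P) * Q^`().
have WE x : Q.[x] = 0 -> W.[x] = - ((P.[x] + c) * Q^`().[x]).
  by move=> Qx; rewrite !hornerE Qx; ring.
have W0 : W != 0.
  apply: contraNneq Pe12 => W0.
  have val e : Q.[e] = 0 -> P.[e] = - c.
    move=> Qe; have := WE e Qe; rewrite W0 horner0 => /esym/eqP.
    by rewrite oppr_eq0 mulf_eq0 (negbTE (simple_root Qe)) orbF addr_eq0 => /eqP.
  by rewrite !val.
have [s hs] := finite_roots W0.
(* The value equation determines [t] unless [Q] vanishes at [x]; then the derivative equation does,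
   because the roots of [Q] are simple. *)
exists [seq if Q.[x] == 0 then - P^`().[x] / Q^`().[x] else - (P.[x] + c) / Q.[x]
       | x <- s] => t x [].
rewrite derivD derivD derivC addr0 derivZ !hornerE => /eqP; rewrite addr_eq0 => /eqP PE.
move=> /eqP; rewrite addr_eq0 => /eqP dPE.
have xs : x \in s by apply: hs; rewrite !hornerE PE dPE; ring.
apply/mapP; exists x => //; rewrite PE dPE !opprK.
by case: eqVneq => [/simple_root|] Qx; rewrite mulfK.
Qed.

Variables (a b : F).
Hypotheses (a0 : a != 0) (b0 : b != 0).

(** Evaluation at [(e1, 0, 0)] and [(e2, 0, 0)], where [Q] vanishes, gives [s (P(e1) - P(e2)) = 0],
    so [s = 0]. The derivative at the simple root [e1] then gives [t = 0]. *)
Lemma separated_independent s t :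
  s *: separated P a b + t *: univariate 0 Q = 0 -> s = 0 /\ t = 0.
Proof.
move=> E; have val v := congr1 (meval v) E.
have s0 : s = 0.
  have v1 := val (fun i => if i == 0 then e1 else 0).
  have v2 := val (fun i => if i == 0 then e2 else 0).
  move: v1 v2; rewrite !meval_separated /= !meval0 Qe1 Qe2 !mulr0 !addr0 => v1 v2.
  apply/eqP; apply: contraNT Pe12 => s0.
  by have /(mulfI s0)/addIr/addIr-> := etrans v1 (esym v2).
split=> //; have := congr1 (fun p => (mderiv 0 p).@[fun=> e1]) E.
rewrite /= mderiv0_separated s0 mul0r add0r mderiv0 meval0 => /eqP.
by rewrite mulf_eq0 (negbTE (simple_root Qe1)) orbF => /eqP.
Qed.

Lemma finite_singular_members : exists S : seq F, forall s t v,
  s *: separated P a b + t *: univariate 0 Q != 0 ->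
  (s *: separated P a b + t *: univariate 0 Q).@[v] = 0 ->
  (forall i, ((s *: separated P a b + t *: univariate 0 Q)^`M(i)).@[v] = 0) ->
  s != 0 /\ t / s \in S.
Proof.
have /boolp.choice[T hT] := finite_double_root_members.
have [r hr] := finite_roots dP0.
exists (flatten [seq T (a * P.[y] + b * P.[z]) | y <- r, z <- r]) => s t v.
set p := _ + _ => p0; rewrite meval_separated => pv dpv.
move: (dpv 0) (dpv 1) (dpv 2); rewrite mderiv0_separated mderiv1_separated.
rewrite mderiv2_separated => d0 d1 d2.
have s0 : s != 0.
  (* For [s = 0] the member is a multiple of [Q] in the first variable, which has no singular point
     since [Q] is separable. *)
  apply: contraNneq p0 => s0; move: pv d0; rewrite /p s0 !mul0r !add0r scale0r add0r.
  have [-> _ _|t0] := eqVneq t 0; first by rewrite scale0r.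
  move=> /eqP; rewrite mulf_eq0 (negbTE t0) => /eqP/simple_root/negbTE Q'v /eqP.
  by rewrite mulf_eq0 (negbTE t0) Q'v.
split=> //.
have y_r : v 1 \in r.
  by apply: hr; move/eqP: d1; rewrite !mulf_eq0 (negbTE s0) (negbTE a0) => /eqP.
have z_r : v 2 \in r.
  by apply: hr; move/eqP: d2; rewrite !mulf_eq0 (negbTE s0) (negbTE b0) => /eqP.
apply/flattenP; exists (T (a * P.[v 1] + b * P.[v 2])).
  by apply/allpairsP; exists (v 1, v 2).
apply: (hT _ _ (v 0)); split; apply: (mulfI s0); rewrite mulr0.
  by rewrite -[RHS]pv !(hornerD, hornerZ, hornerC); field.
by rewrite -[RHS]d0 derivD derivD derivC addr0 derivZ !(hornerD, hornerZ); field.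
Qed.
End FinitelyManySingular.

(** * The real pencil of surfaces and its singular members *)

Section SeparatedPencil.
Variables (R : realType) (d : nat) (P Q : {poly R}) (a b e1 e2 : R).
Hypotheses (sizeP : (size P <= d.+1)%N) (sizeQ : (size Q <= d.+1)%N).
Hypotheses (dP0 : P^`() != 0) (sepQ : separable_poly Q).
Hypotheses (Qe1 : Q.[e1] = 0) (Qe2 : Q.[e2] = 0) (Pe12 : P.[e1] != P.[e2]).
Hypotheses (a0 : a != 0) (b0 : b != 0).

Let C : closedFieldType := R[i]%C.
Let inC : {rmorphism R -> C} := real_complex R.
Let PC := map_poly inC P.
Let QC := map_poly inC Q.
Let f := complexify (separated P a b).
Let g := complexify (univariate 0 Q).

Definition separated_pencil := spanned_by f g.

Let fE : f = separated PC (inC a) (inC b).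
Proof.
rewrite /f /complexify /separated !rmorphD /= !map_mpolyZ.
by rewrite !(map_univariate inC).
Qed.

Let gE : g = univariate 0 QC.
Proof. exact: (map_univariate inC). Qed.

Let dPC0 : PC^`() != 0. Proof. by rewrite deriv_map map_poly_eq0. Qed.

Let sepQC : separable_poly QC.
Proof. by rewrite separable_map. Qed.

Let QCe1 : QC.[inC e1] = 0. Proof. by rewrite horner_map Qe1 rmorph0. Qed.
Let QCe2 : QC.[inC e2] = 0. Proof. by rewrite horner_map Qe2 rmorph0. Qed.
Let PCe12 : PC.[inC e1] != PC.[inC e2].
Proof. by rewrite !horner_map (inj_eq (fmorph_inj inC)). Qed.
Let aC0 : inC a != 0. Proof. by rewrite fmorph_eq0. Qed.
Let bC0 : inC b != 0. Proof. by rewrite fmorph_eq0. Qed.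

Let independent (s t : C) : s *: f + t *: g = 0 -> s = 0 /\ t = 0.
Proof. by rewrite fE gE; apply: (separated_independent sepQC QCe1 QCe2 PCe12). Qed.

Let univariate_simplex (i : 'I_3) (p : {poly C}) : (size p <= d.+1)%N ->
  in_simplex d (univariate i p).
Proof. by move=> sp m /msupp_univariate /leq_trans/(_ sp). Qed.

Let simplexD (p q : {mpoly C[3]}) (c : C) :
  in_simplex d p -> in_simplex d q -> in_simplex d (p + c *: q).
Proof.
move=> hp hq m /msuppD_le; rewrite mem_cat => /orP[/hp//|/msuppZ_le/hq//].
Qed.

Lemma separated_pencil_real : is_real_pencil d separated_pencil.
Proof.
split; last by exists (separated P a b), (univariate 0 Q).
exists f, g; split=> //.
  have sPC : (size PC <= d.+1)%N by rewrite size_map_poly.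
  by rewrite fE; do 2?apply: simplexD; apply: univariate_simplex.
by rewrite gE; apply: univariate_simplex; rewrite size_map_poly.
Qed.

Lemma separated_pencil_generic : generic_pencil separated_pencil.
Proof.
have [S hS] := finite_singular_members dPC0 sepQC QCe1 QCe2 PCe12 aC0 bC0.
exists (size S), (fun i => f + S`_i *: g) => p [p0 [s [t pE]]] [v _ [pv dpv]].
have [s0 tS] : s != 0 /\ t / s \in S.
  by apply: (hS s t v); rewrite -fE -gE -pE.
have iS : (index (t / s) S < size S)%N by rewrite index_mem.
(* Division by the nonzero [s] normalizes the member to [f + (t / s) g], one surface for each entry
   of [S]. *)
exists (Ordinal iS), s => //=.
by rewrite nth_index // scalerDr scalerA mulrCA divff // mulr1.
Qed.

(** The real singular points remain singular over the complex numbers, and positive coordinates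
    place them in the torus. *)
Lemma separated_pencil_members (J : finType) (T : J -> R) :
  injective T ->
  (forall j, exists v : 'I_3 -> R, [/\ forall i, 0 < v i,
     double_root (P + (a * P.[v 1] + b * P.[v 2])%:P + T j *: Q) (v 0),
     P^`().[v 1] = 0 & P^`().[v 2] = 0]) ->
  has_real_singular_surfaces separated_pencil #|J|.
Proof.
move=> TI hT.
pose F (j : J) := f + inC (T j) *: g.
exists (fun i => F (enum_val i)); split=> [i|i j [c c0 E]]; last first.
  apply/enum_val_inj/TI/(fmorph_inj inC).
  (* Proportional members give a linear relation between [f] and [g]: its first coefficient forces
     [c = 1], and its second then forces equal parameters. *)
  have [] := @independent (1 - c) (inC (T (enum_val j)) - c * inC (T (enum_val i))).
    apply: etrans (_ : _ = F (enum_val j) - c *: F (enum_val i)) _.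
      by rewrite /F scalerDr scalerA !scalerBl scale1r opprD addrACA.
    by rewrite E subrr.
  by move=> /eqP; rewrite subr_eq0 => /eqP <- /eqP; rewrite mul1r subr_eq0 => /eqP.
move: (enum_val i) => {}i; split.
- split; last by exists 1, (inC (T i)); rewrite scale1r.
  apply/eqP => E; have [|/eqP] := @independent 1 (inC (T i)); rewrite ?scale1r //.
  by rewrite oner_eq0.
- exists (separated P a b + T i *: univariate 0 Q), 1; first exact: oner_neq0.
  by rewrite scale1r /complexify rmorphD /= map_mpolyZ.
have [v [v0 [Pv dPv] v1 v2]] := hT i.
exists (inC \o v) => [j|]; first by rewrite /= fmorph_eq0 lt0r_neq0.
rewrite /F -[f]scale1r fE gE; split.
  rewrite meval_separated /= !horner_map /= mul1r -!(rmorphM, rmorphD) /=.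
  rewrite -[RHS](rmorph0 inC) -[in RHS]Pv; congr (inC _).
  by rewrite !(hornerD, hornerZ, hornerC); ring.
move=> j; case: (ord3_cases j) => ->.
- rewrite mderiv0_separated /= !deriv_map !horner_map /= mul1r -!(rmorphM, rmorphD) /=.
  rewrite -[RHS](rmorph0 inC) -[in RHS]dPv; congr (inC _).
  by rewrite derivD derivD derivC addr0 derivZ !(hornerD, hornerZ).
- by rewrite mderiv1_separated /= deriv_map horner_map /= v1 rmorph0 !mulr0.
- by rewrite mderiv2_separated /= deriv_map horner_map /= v2 rmorph0 !mulr0.
Qed.
End SeparatedPencil.

Theorem theorem5p1 (R : realType) :
  exists C : R, 0 < C /\
    forall d : nat, (2 <= d)%N ->
      exists L : {mpoly R[i][3]} -> Prop,
        [/\ is_real_pencil d L,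
            generic_pencil L
          & exists n : nat,
              has_real_singular_surfaces L n /\
              3%:R / 2%:R * d%:R ^+ 3 - C * d%:R ^+ 2 <= n%:R].
Proof.
(* The construction gives [2 (d - 1)^3] members, and [2 (d - 1)^3 >= 2 d^3 - 6 d^2]. *)
exists 6; split=> // d d2.
have [P [Q [[sizeP sizeQ] sepQ [e1 [e2 [Qe1 Qe2 Pe12]]] [t [tI tst]] [y [hy yI]]]]] :=
  univariate_pencil R d2.
have [lam lam0 wI] := generic_sum_injective yI.
have [eps eps0 [T [TI hT]]] := stable_contact_members tI tst wI.
have dP0 : P^`() != 0 by rewrite -size_poly_eq0 size_deriv sizeP -lt0n ltnW.
have el0 : eps * lam != 0 by rewrite mulf_neq0.
(* With these coefficients the constant added to [P(x)] at the critical points [y k] and [y l] is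
   [eps (P(y k) + lam P(y l))], which is [eps] times the injective family given by [wI]. *)
exists (separated_pencil P Q eps (eps * lam)); split.
- by apply: (separated_pencil_real _ _ _ _ sepQ Qe1 Qe2 Pe12); rewrite ?sizeP ?sizeQ.
- exact: (separated_pencil_generic dP0 sepQ Qe1 Qe2 Pe12 eps0 el0).
exists #|{: bool * 'I_d.-1 * ('I_d.-1 * 'I_d.-1)}|; split.
  apply: (separated_pencil_members sepQ Qe1 Qe2 Pe12 TI) => -[j [k l]].
  have [x x0] := hT (j, (k, l)); rewrite /= mulrDr mulrA => hx.
  exists (fun i => if i == 0 then x else if i == 1 then y k else y l).
  have [yk dyk] := hy k; have [yl dyl] := hy l.
  by split=> //= i; case: ifP => // _; case: ifP.
rewrite !card_prod card_bool !card_ord.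
case: d d2 {P Q sizeP sizeQ sepQ e1 e2 Qe1 Qe2 Pe12 t tI tst y hy yI wI T TI hT dP0}
  => [//|n] _ /=.
rewrite !natrM -[n.+1%:R]natr1; have : 0 <= n%:R :> R by [].
move: (n%:R : R) => u u0; have u2 : 0 <= u ^+ 2 by apply: exprn_ge0.
have u3 : 0 <= u ^+ 3 by apply: exprn_ge0.
nra.
Qed.
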